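(* Let $k\ge 2$ be an integer. For any $(u,v)\in[0,1]^2$, write $u=\tfrac ik+\tfrac tk$ and $v=\tfrac jk+\tfrac sk$, where $i=\lfloor uk\rfloor$, $j=\lfloor vk\rfloor\in\{0,1,\dots,k\}$, $t=uk-i\in[0,1)$ and $s=vk-j\in[0,1)$. Then $$\mathbb{E}[\widehat{Y}_k(u,v)]=\mathbb{E}[\widehat{X}_k(u,v)]=uv$$ and $$\mathbb{V}[\widehat{Y}_k(u,v)]=\frac{1}{k!+1}\,\mathbb{V}[\widehat{X}_k(u,v)]=\frac{1}{(k!+1)(k-1)}\Big(u(1-u)-\frac{t(1-t)}{k}\Big)\Big(v(1-v)-\frac{s(1-s)}{k}\Big),$$ where $\mathbb{E}$ and $\mathbb{V}$ denote expected value and variance.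
   Context: Fix an integer $k\ge 2$. Let $[k]=\{1,\dots,k\}$, $\delta_k=\{0,\tfrac1k,\dots,\tfrac{k-1}{k},1\}$ and $\Delta_k=\delta_k\times\delta_k$. Let $\mathcal{S}_k$ be the set of all permutations of $[k]$. For $\pi\in\mathcal{S}_k$, let $C_\pi\colon\Delta_k\to[0,1]$ be the discrete copula with mass $\tfrac1k$ in each square $[\tfrac{i-1}{k},\tfrac ik]\times[\tfrac{\pi(i)-1}{k},\tfrac{\pi(i)}{k}]$, $i\in[k]$, and mass $0$ in all other squares of the mesh; that is, $C_\pi(\tfrac ik,\tfrac jk)=\tfrac1k\,|\{m\in[k] : m\le i,\ \pi(m)\le j\}|$ for $i,j\in\{0,1,\dots,k\}$. The (piecewise) bilinear extension (checkerboard copula) $\widehat{C}_\pi\colon[0,1]^2\to[0,1]$ of $C_\pi$ is defined, for $(u,v)\in[0,1]^2$ with $i=\lfloor uk\rfloor$, $j=\lfloor vk\rfloor$, $t=uk-i$, $s=vk-j$, by $$\widehat{C}_\pi(u,v)=(1-t)(1-s)C_\pi(\tfrac ik,\tfrac jk)+t(1-s)C_\pi(\tfrac{i+1}{k},\tfrac jk)+(1-t)s\,C_\pi(\tfrac ik,\tfrac{j+1}{k})+ts\,C_\pi(\tfrac{i+1}{k},\tfrac{j+1}{k}),$$ where terms involving an index $k+1$ (which occur only with coefficient $0$) are understood to be $0$. The random field $\widehat{X}_k$ over $[0,1]^2$ is given by $\widehat{X}_k(u,v)=\widehat{C}_\pi(u,v)$, where $\pi$ is chosen uniformly at random from $\mathcal{S}_k$.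 Let $\sigma^{k!-1}=\{(\alpha_\pi)_{\pi\in\mathcal{S}_k}\in\mathbb{R}^{k!} : \alpha_\pi\ge 0 \text{ for all } \pi,\ \sum_{\pi\in\mathcal{S}_k}\alpha_\pi=1\}$ be the standard simplex. The random field $\widehat{Y}_k$ over $[0,1]^2$ is given by $\widehat{Y}_k(u,v)=\sum_{\pi\in\mathcal{S}_k}\alpha_\pi\widehat{C}_\pi(u,v)$, where $\boldsymbol{\alpha}=(\alpha_\pi)_{\pi\in\mathcal{S}_k}$ is distributed uniformly over $\sigma^{k!-1}$ with respect to the Lebesgue measure on the simplex (equivalently, $\boldsymbol{\alpha}$ has the Dirichlet distribution with all $k!$ parameters equal to $1$). *)

(* Defs.v *)
From HB Require Import structures.
From mathcomp Require Export all_boot all_order all_fingroup all_algebra.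
From mathcomp Require Export all_classical all_reals all_analysis.

Set Implicit Arguments.
Unset Strict Implicit.
Unset Printing Implicit Defensive.

Import Order.TTheory GRing.Theory Num.Theory.
Import numFieldNormedType.Exports.

Local Open Scope classical_set_scope.
Local Open Scope ring_scope.

Section CheckerboardCopula.
Context {R : realType} (k : nat).

(* The value C_pi(i/k, j/k), extended by 0 off the mesh.  Permutations act on
   'I_k = {0, ..., k-1}, so the condition m <= i on {1, ..., k} is m < i here. *)
Definition discrete_copula (p : 'S_k) (i j : nat) : R :=
  if (i <= k)%N && (j <= k)%N then
    #|[pred m : 'I_k | (m < i)%N && (p m < j)%N]|%:R / k%:R
  else 0.

(* On nonnegative reals, Num.truncn is the floor. *)
Definition checkerboard_copula (p : 'S_k) (u v : R) : R :=
  let i := Num.truncn (u * k%:R) in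
  let j := Num.truncn (v * k%:R) in
  let t := u * k%:R - i%:R in
  let s := v * k%:R - j%:R in
  (1 - t) * (1 - s) * discrete_copula p i j
  + t * (1 - s) * discrete_copula p i.+1 j
  + (1 - t) * s * discrete_copula p i j.+1
  + t * s * discrete_copula p i.+1 j.+1.

End CheckerboardCopula.

Definition uniform_perm {R : realType} {d : measure_display}
    {T : measurableType d} (k : nat) (P : probability T R) (pi : T -> 'S_k) :=
  forall p : 'S_k, measurable (pi @^-1` [set p]) /\
    P (pi @^-1` [set p]) = ((k`!%:R)^-1)%:E.

Definition checkerboard_field {R : realType} {T : Type} (k : nat)
    (pi : T -> 'S_k) (u v : R) : T -> R :=
  fun w => checkerboard_copula (pi w) u v.

Definition mixture_field {R : realType} {T : Type} (k : nat)
    (alpha : 'S_k -> T -> R) (u v : R) : T -> R :=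
  fun w => \sum_(p : 'S_k) alpha p w * checkerboard_copula p u v.

Section UniformSimplex.
Context {R : realType}.

(* Lebesgue measure on R^n, as an iterated product. *)
Fixpoint lebesgue_tuple (n : nat) : set (n.-tuple R) -> \bar R :=
  match n with
  | 0%N => fun A => \d_([tuple]) A
  | m.+1 => fun A => (@lebesgue_measure R \x @lebesgue_tuple m)%E
      [set xy : R * m.-tuple R | A (cons_tuple xy.1 xy.2)]
  end.

Definition simplex (I : finType) : set (I -> R) :=
  [set a | (forall i, 0 <= a i) /\ \sum_i a i = 1].

(* The affine parametrization of the hyperplane of points with coordinate sum 1
   by its first #|I| - 1 coordinates (in the order of enum I); the last
   coordinate of I falls outside x and gets the default value of nth. *)
Definition simplex_chart (I : finType) (x : #|I|.-1.-tuple R) : I -> R :=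
  fun i => nth (1 - \sum_(y <- x) y) x (enum_rank i).

(* The chart is affine and injective, so this is the Lebesgue (surface) measure
   on the simplex up to a constant factor, which is irrelevant after
   normalization.  Points of R^I are encoded as #|I|-tuples, on which the
   library provides the product sigma-algebra. *)
Definition simplex_measure (I : finType) (B : set (#|I|.-tuple R)) : \bar R :=
  @lebesgue_tuple #|I|.-1 [set x |
    simplex (simplex_chart x) /\ B (codom_tuple (simplex_chart x))].

Definition uniform_on_simplex {d : measure_display} {T : measurableType d}
    (P : probability T R) (I : finType) (alpha : I -> T -> R) :=
  forall B : set (#|I|.-tuple R), measurable B ->
    P [set w | B (codom_tuple (alpha ^~ w))] =
    (simplex_measure B / @simplex_measure I setT)%E.

End UniformSimplex.

(* Main.v *)
Require Import Defs.
From mathcomp Require Import measurable_realfun ring.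

(* On the simplex with n vertices, P(alpha_i >= a_i for all i) equals
   (1 - sum a)^(n-1) for a >= 0: the first n-1 coordinates range over a corner
   simplex, whose volume is computed one coordinate at a time.  Integrating
   these tail probabilities (layer cake) gives E[alpha_p] = 1/n and
   E[alpha_p alpha_q] = 1/(n(n+1)) for p <> q, and then E[alpha_p^2] follows
   from sum alpha = 1.  With c_p centred this yields
   E[(sum alpha_p c_p)^2] = sum c_p^2 / (n(n+1)), i.e. V[Y] = V[X]/(n+1).
   For X, the copula at (u, v) is the linear permutation statistic
   (1/k) sum_m a_m b_(pi m), where a_m and b_m are the fractions of the m-th
   cells below u and v; after centring a and b its second moment follows
   because b_(pi m) b_(pi m') has the same mean for all m <> m'. *)

Set Implicit Arguments.
Unset Strict Implicit.
Unset Printing Implicit Defensive.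

Import Order.TTheory GRing.Theory Num.Theory.
Import numFieldNormedType.Exports.

Local Open Scope classical_set_scope.
Local Open Scope ring_scope.

(** * Volumes of corner simplices *)

(* [tpow m (c - sum a)] is the volume of {x in R^m | x_j >= a_j, sum x <= c},
   including the case m = 0, where the set is empty for c < 0. *)
Definition tpow {R : realType} (m : nat) (x : R) : R :=
  if 0 <= x then x ^+ m / m`!%:R else 0.

Lemma is_derive_subX {R : realType} (m : nat) (d x : R) :
  is_derive x 1 (fun y : R => - ((d - y) ^+ m.+1 / m.+1`!%:R))
    ((d - x) ^+ m / m`!%:R).
Proof.
have H : is_derive x 1 (fun y : R => d - y) (0 - 1) by exact: is_deriveB.
have H2 := is_deriveX m.+1 H.
have H3 := @is_deriveM _ _ _ (cst (- (m.+1`!%:R)^-1)) x 1 _ _ H2 (is_derive_cst _ x 1).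
apply: is_derive_eq.
  rewrite (_ : (fun y => _) = (fun y : R => d - y) ^+ m.+1 * cst (- (m.+1`!%:R)^-1)).
    exact: H3.
  by apply/funext => y /=; rewrite mulrN fctE.
rewrite /= scaler0 add0r /GRing.scale/= factS natrM.
have : (m.+1%:R : R) != 0 by rewrite pnatr_eq0.
have : (m`!%:R : R) != 0 by rewrite pnatr_eq0 -lt0n fact_gt0.
move: (_`!%:R) (m.+1%:R) => p q p0 q0; field.
by rewrite q0 p0.
Qed.

(** This is the inductive step of the volume formula: integrating over one more coordinate raises
    the exponent by one. The integrand vanishes for [x > d], which leaves a polynomial on [[a, d]]
    for the fundamental theorem of calculus; when [d < a] both sides are 0. *)
Lemma integral_tpow {R : realType} (m : nat) (a d : R) :
  (\int[lebesgue_measure]_(x in `[a, +oo[) (tpow m (d - x))%:E =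
   (tpow m.+1 (d - a))%:E)%E.
Proof.
have -> : (\int[@lebesgue_measure R]_(x in `[a, +oo[) (tpow m (d - x))%:E =
   \int[lebesgue_measure]_(x in `[a, d]) ((d - x) ^+ m / m`!%:R)%:E)%E.
  rewrite integral_mkcond [RHS]integral_mkcond; apply: eq_integral => x _.
  rewrite !patchE !mem_setE !in_itv/= andbT /tpow subr_ge0.
  by case: (a <= x); case: (x <= d).
rewrite /tpow subr_ge0; have [ad|da|<-] := ltgtP a d.
- rewrite (@continuous_FTC2 _ _ (fun y : R => - ((d - y) ^+ m.+1 / m.+1`!%:R))) //.
  + by rewrite subrr expr0n /= mul0r oppr0 -EFinB opprK add0r.
  + apply: continuous_subspaceT => x.
    apply: cvgMl; apply: (@cvg_comp _ _ _ _ (fun y => y ^+ m) _ (nbhs (d - x))).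
    by apply: cvgB; [exact: cvg_cst|exact: cvg_id].
    exact: exprn_continuous.
  + have D x : derivable (fun y : R => - ((d - y) ^+ m.+1 / m.+1`!%:R)) x 1.
      by have [] := is_derive_subX m d x.
    have C : continuous (fun y : R => - ((d - y) ^+ m.+1 / m.+1`!%:R)).
      by move=> x; apply: differentiable_continuous; exact/derivable1_diffP.
    split => //; [exact/cvg_at_right_filter/C|exact/cvg_at_left_filter/C].
  + by move=> x _; rewrite derive1E; have [_ ->] := is_derive_subX m d x.
- by rewrite set_itv_ge ?integral_set0// bnd_simp -ltNge.
- by rewrite set_itv1 integral_set1 subrr expr0n mul0r.
Qed.

Lemma lebesgue_tuple0 {R : realType} (m : nat) :
  lebesgue_tuple (set0 : set (m.-tuple R)) = 0%E.
Proof.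
elim: m => [|m IH] /=; first by rewrite diracE in_set0.
rewrite /product_measure1; apply: integral0_eq => x _ /=.
by rewrite -[RHS]IH; congr lebesgue_tuple; exact: xsection0.
Qed.

(** Induction by slicing along the first coordinate: the slice at [x] is empty for [x < a 0], and
    otherwise is the box of the remaining bounds with [c] replaced by [c - x]. *)
Lemma lebesgue_tuple_box {R : realType} (m : nat) (a : nat -> R) (c : R) :
  lebesgue_tuple [set x : m.-tuple R |
    (forall j : 'I_m, a j <= tnth x j) /\ \sum_(y <- x) y <= c] =
  (tpow m (c - \sum_(j < m) a j))%:E.
Proof.
elim: m a c => [|m IH] a c /=.
  rewrite diracE big_ord0 subr0 /tpow expr0 fact0 divr1.
  rewrite (_ : _ \in _ = (0 <= c)); first by case: (0 <= c).
  rewrite -[RHS]asboolb; apply/asbool_equiv_eq; split => /=.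
    by case; rewrite big_nil.
  by move=> c0; rewrite big_nil; split => // -[].
rewrite /product_measure1 big_ord_recl/=.
transitivity (\int[@lebesgue_measure R]_(x in `[a 0%N, +oo[)
    (tpow m ((c - \sum_(j < m) a j.+1) - x))%:E)%E; last first.
  by rewrite integral_tpow; congr (tpow _ _)%:E; rewrite addrAC opprD addrA.
rewrite [RHS]integral_mkcond; apply: eq_integral => x _ /=.
rewrite patchE mem_setE in_itv/= andbT; case: ifPn => [ax|]; last first.
  rewrite -ltNge => xa; rewrite -[RHS](@lebesgue_tuple0 R m); congr lebesgue_tuple.
  apply/seteqP; split => // y /=; rewrite /xsection/= in_setE/= => -[/(_ ord0)].
  by rewrite tnth0 leNgt xa.
rewrite addrAC -(IH (fun j => a j.+1)); congr lebesgue_tuple.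
apply/seteqP; split => y; rewrite /xsection/= in_setE/= big_cons => -[ay yc].
  split => [j|]; last by rewrite lerBrDl.
  by have := ay (lift ord0 j); rewrite tnthS.
split => [j|]; last by rewrite -lerBrDl.
case: (unliftP ord0 j) => [i|] ->; last by rewrite (tnth_nth 0).
by rewrite tnthS; exact: ay.
Qed.

Lemma sum_simplex_chart {R : realType} (I : finType) (x : #|I|.-1.-tuple R) :
  (0 < #|I|)%N -> \sum_i simplex_chart x i = 1.
Proof.
move=> I0; rewrite (reindex (@enum_val I I)) /=; last exact/onW_bij/enum_val_bij.
rewrite /simplex_chart; under eq_bigr do rewrite enum_valK.
set d := 1 - _.
(* The index [#|I|.-1] lies just past the end of [x], so its summand is the default [d], which
   completes the sum to 1. *)
rewrite -(big_mkord xpredT (fun j => nth d x j)).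
rewrite -[X in index_iota _ X](prednK I0) big_nat_recr//= nth_default ?size_tuple//.
by rewrite {2}/d [\sum_(y <- x) y](big_nth d) size_tuple addrCA subrr addr0.
Qed.

(** The sum condition belongs to the set because a uniform vector lies on the simplex only almost
    surely. *)
Definition simplex_box {R : realType} (I : finType) (a : I -> R) :
    set (#|I|.-tuple R) :=
  [set y | (forall j, a (enum_val j) <= tnth y j) /\ \sum_j tnth y j = 1].

Lemma measurable_simplex_box {R : realType} (I : finType) (a : I -> R) :
  measurable (simplex_box a).
Proof.
rewrite (_ : simplex_box a = \bigcap_(j in setT) [set y | a (enum_val j) <= tnth y j] `&`
  [set y | \sum_j tnth y j = 1]); last first.
  apply/seteqP; split => y [ay y1]; split => // j; first by move=> _; exact: ay.
  exact: ay.
apply: measurableI.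
  apply: fin_bigcap_measurable => // j _.
  rewrite -[X in measurable X]setTI; apply: measurable_fun_le => //.
  exact: measurable_tnth.
rewrite (_ : [set y | _] = (fun y : #|I|.-tuple R => \sum_j tnth y j) @^-1` [set 1])//.
rewrite -[X in measurable X]setTI.
apply: measurable_sum => // j; exact: measurable_tnth.
Qed.

Lemma codom_simplex_box {R : realType} (I : finType) (a f : I -> R) :
  simplex_box a (codom_tuple f) <-> (forall i, a i <= f i) /\ \sum_i f i = 1.
Proof.
have H j : tnth (codom_tuple f) j = f (enum_val j).
  by rewrite (tnth_nth 0) /= nth_codom.
rewrite /simplex_box /=; under eq_bigr do rewrite H.
have -> : \sum_i f i = \sum_j f (@enum_val I I j).
  by rewrite (reindex (@enum_val I I)) /=; last exact/onW_bij/enum_val_bij.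
split => -[af ->]; split => // i.
  by rewrite -(enum_rankK i) -H.
by rewrite H.
Qed.

(** In the chart, the bound on the last coordinate [1 - \sum x] reads [\sum x <= 1 - a_last], while
    the other bounds stay as they are. This is a corner simplex in dimension [#|I|.-1]. The
    nonnegativity built into [simplex] follows from [0 <= a]. *)
Lemma simplex_measure_box {R : realType} (I : finType) (a : I -> R) :
  (0 < #|I|)%N -> (forall i, 0 <= a i) ->
  simplex_measure (simplex_box a) = (tpow #|I|.-1 (1 - \sum_i a i))%:E.
Proof.
move=> I0 a0; pose b := nth 0 (codom a).
have bE (i : I) : a i = b (enum_rank i) by rewrite /b nth_codom enum_rankK.
have bE' (i : 'I_#|I|) : b i = a (enum_val i) by rewrite bE enum_valK.
have -> : \sum_i a i = \sum_(j < #|I|.-1) b j + b #|I|.-1.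
  rewrite (reindex (@enum_val I I)) /=; last exact/onW_bij/enum_val_bij.
  rewrite -(big_mkord xpredT b) -big_nat_recr//= prednK// big_mkord.
  by apply: eq_bigr => j _; rewrite bE'.
rewrite opprD addrA addrAC -lebesgue_tuple_box /simplex_measure.
congr lebesgue_tuple; apply/seteqP; split => x /=.
  move=> [_ /codom_simplex_box[ax _]]; split => [j|].
    have jI : (j < #|I|)%N by rewrite (leq_trans (ltn_ord j))// leq_pred.
    have := ax (enum_val (Ordinal jI)); rewrite -bE' /simplex_chart enum_valK.
    by rewrite (tnth_nth (1 - \sum_(y <- x) y)).
  have jI : (#|I|.-1 < #|I|)%N by rewrite prednK.
  have := ax (enum_val (Ordinal jI)); rewrite -bE' /simplex_chart enum_valK/=.
  by rewrite nth_default ?size_tuple// lerBrDl lerBrDl addrC.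
move=> [bx xb].
have ax i : a i <= simplex_chart x i.
  rewrite /simplex_chart bE; have [ilt|ige] := ltnP (enum_rank i) #|I|.-1.
    by have := bx (Ordinal ilt); rewrite (tnth_nth (1 - \sum_(y <- x) y)).
  rewrite nth_default ?size_tuple//.
  have -> : enum_rank i = #|I|.-1 :> nat.
    by apply/eqP; rewrite eqn_leq ige andbT -ltnS prednK.
  by rewrite lerBrDl addrC -lerBrDl.
have x1 := sum_simplex_chart x I0.
split; first by split => // i; exact: le_trans (ax i).
exact/codom_simplex_box.
Qed.

(** * Moments of the uniform distribution on the simplex *)

Lemma uniform_on_simplex_box {R : realType} d (T : measurableType d)
    (P : probability T R) (I : finType) (alpha : I -> T -> R) (a : I -> R) :
  (0 < #|I|)%N -> uniform_on_simplex P alpha -> (forall i, 0 <= a i) ->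
  P [set w | (forall i, a i <= alpha i w) /\ \sum_i alpha i w = 1] =
  (#|I|.-1`!%:R * tpow #|I|.-1 (1 - \sum_i a i))%:E.
Proof.
move=> I0 Ha a0.
have := Ha _ (measurable_simplex_box a); rewrite (simplex_measure_box I0 a0).
have -> : [set w | simplex_box a (codom_tuple (alpha ^~ w))] =
    [set w | (forall i, a i <= alpha i w) /\ \sum_i alpha i w = 1].
  by apply/seteqP; split => w /=; rewrite codom_simplex_box.
(* The normalizing constant is itself a box volume, for the zero bounds: [1 / (n-1)!] with
   [n = #|I|]. *)
have -> : @simplex_measure R I setT = simplex_measure (simplex_box (cst 0 : I -> R)).
  rewrite /simplex_measure; congr lebesgue_tuple.
  apply/seteqP; split => x /=; last by case.
  by move=> [[x0 x1] _]; split => //; apply/codom_simplex_box.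
have -> : simplex_measure (simplex_box (cst 0 : I -> R)) = ((#|I|.-1`!%:R)^-1)%:E.
  by rewrite (simplex_measure_box I0)// big1// subr0 /tpow ler01 expr1n div1r.
by move=> ->; rewrite inver invr_eq0 pnatr_eq0 eqn0Ngt fact_gt0/= invrK muleC.
Qed.

(** On [D], [Y w] is the length of [[0, Y w]], and Tonelli exchanges the two integrals. The weight
    [Z] lets the formula be applied to a product, one factor at a time. *)
Lemma layer_cake {R : realType} d (T : measurableType d)
    (P : probability T R) (D : set T) (Z Y : T -> R) :
  measurable D -> measurable_fun setT Z -> measurable_fun setT Y ->
  (forall w, D w -> 0 <= Z w) -> (forall w, D w -> 0 <= Y w) ->
  (\int[P]_(w in D) (Z w * Y w)%:E =
   \int[lebesgue_measure]_(b in `[0%R, +oo[)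
     \int[P]_(w in D `&` [set w | (b <= Y w)%R]) (Z w)%:E)%E.
Proof.
move=> mD mZ mY Z0 Y0.
(* The region between 0 and the graph of [Y] over [D]; both iterated integrals are those of [Z]
   restricted to it. *)
pose A := [set wb : T * measurableTypeR R | D wb.1 /\ 0 <= wb.2 <= Y wb.1].
have mA : measurable A.
  have -> : A = (D `*` `[0%R, +oo[) `&`
      (setT `&` [set wb : T * measurableTypeR R | wb.2 <= Y wb.1]).
    apply/seteqP; split => -[w b] /=; rewrite in_itv/= andbT.
      by move=> [Dw /andP[b0 bY]].
    by move=> [[Dw b0] [_ bY]]; split => //; apply/andP.
  apply: measurableI; first exact: measurableX.
  apply: measurable_fun_le => //.
  exact: measurableT_comp.
pose f (wb : T * measurableTypeR R) : \bar R := (Z wb.1 * \1_A wb)%:E.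
have mf : measurable_fun [set: T * measurableTypeR R] f.
  apply/measurable_EFinP; apply: measurable_funM; first exact: measurableT_comp.
  exact: measurable_indic.
have f0 wb : (0 <= f wb)%E.
  rewrite /f lee_fin indicE; case: (boolP (wb \in A)) => [|_]; last by rewrite mulr0.
  by rewrite inE mulr1 => -[/Z0].
transitivity (\int[P]_w \int[@lebesgue_measure R]_b f (w, b))%E.
  rewrite integral_mkcond; apply: eq_integral => w _; rewrite patchE.
  case: ifPn => wD; last first.
    apply/esym/integral0_eq => b _; rewrite /f indicE memNset ?mulr0//.
    by move=> [/mem_set]; rewrite (negbTE wD).
  transitivity (\int[@lebesgue_measure R]_(b in `[0%R, Y w]) (cst (Z w)%:E) b)%E.
    rewrite integral_cst//= lebesgue_measure_itv/= lte_fin EFinM.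
    have := Y0 _ (set_mem wD); rewrite le_eqVlt => /predU1P[<-|->].
      by rewrite ltxx.
    by rewrite oppr0 addr0.
  rewrite integral_mkcond; apply: eq_integral => b _.
  rewrite patchE /f indicE mem_setE in_itv/=.
  rewrite (_ : (w, b) \in A = (0 <= b <= Y w)).
    by case: ifP; rewrite ?mulr1 ?mulr0.
  apply/idP/idP; rewrite inE; first by case.
  by split => //; exact: set_mem.
rewrite (fubini_tonelli _ mf f0) [RHS]integral_mkcond.
apply: eq_integral => b _; rewrite patchE mem_setE in_itv/= andbT.
case: ifPn => b0; last first.
  apply: integral0_eq => w _; rewrite /f indicE memNset ?mulr0//.
  by move=> [_ /andP[]]; rewrite (negbTE b0).
rewrite [RHS]integral_mkcond; apply: eq_integral => w _.
rewrite patchE /f indicE (_ : (w, b) \in A = (w \in D `&` [set w | b <= Y w])).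
  by case: ifP; rewrite ?mulr1 ?mulr0.
apply/idP/idP; rewrite !inE => -[Dw].
  by move=> /andP[].
by move=> /= bY; split => //=; rewrite b0.
Qed.

Lemma tpow_ge0 {R : realType} m (x : R) : 0 <= tpow m x.
Proof. by rewrite /tpow; case: ifP => // x0; rewrite divr_ge0 ?exprn_ge0. Qed.

Lemma measurable_tpow {R : realType} m (d : R) :
  measurable_fun setT (fun x : R => tpow m (d - x)).
Proof.
rewrite /tpow; apply: measurable_fun_ifT => //.
  by apply: measurable_fun_ler => //; exact: measurable_funB.
apply: measurable_funM => //; apply: measurable_funX; exact: measurable_funB.
Qed.

Lemma integral_scale_tpow {R : realType} m (c d : R) : 0 <= c ->
  (\int[lebesgue_measure]_(x in `[0%R, +oo[) (c * tpow m (d - x))%:E =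
   (c * tpow m.+1 d)%:E)%E.
Proof.
move=> c0; under eq_integral do rewrite EFinM.
rewrite ge0_integralZl_EFin//.
- by rewrite integral_tpow subr0 EFinM.
- by move=> x _; rewrite lee_fin tpow_ge0.
- by apply/measurable_EFinP/measurable_funTS; exact: measurable_tpow.
Qed.

(** The coefficients may have any sign, so integrability has to be known first; it comes from
    [f j >= 0] on [D] together with the finite value [m j]. *)
Lemma integral_lincomb {R : realType} d (T : measurableType d)
    (P : probability T R) (D : set T) (J : finType) (f : J -> T -> R) (c m : J -> R) :
  measurable D -> (forall j, measurable_fun setT (f j)) ->
  (forall j w, D w -> 0 <= f j w) ->
  (forall j, (\int[P]_(w in D) (f j w)%:E = (m j)%:E)%E) ->
  (\int[P]_(w in D) (\sum_j c j * f j w)%:E = (\sum_j c j * m j)%:E)%E.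
Proof.
move=> mD mf f0 fm.
have fi j : P.-integrable D (EFin \o f j).
  apply/integrableP; split.
    by apply/measurable_EFinP/measurable_funTS; exact: mf.
  under eq_integral => w wD.
    rewrite /= ger0_norm; last by apply: f0; exact: set_mem.
    over.
  by rewrite fm ltry.
under eq_integral do rewrite -sumEFin.
rewrite integral_sum//; last first.
  by move=> j; exact: (integrableZl mD (c j) (fi j)).
rewrite -sumEFin; apply: eq_bigr => j _.
under eq_integral do rewrite EFinM.
by rewrite (integralZl _ (fi j))// fm.
Qed.

(** Serves to replace the whole space by the almost sure event on which [alpha] really lies in the
    simplex, where its sign and its sum can be used pointwise. *)
Lemma integral_full_measure {R : realType} d (T : measurableType d)
    (P : probability T R) (D : set T) (f : T -> R) :
  measurable D -> P D = 1%E -> measurable_fun setT f ->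
  (\int[P]_w (f w)%:E = \int[P]_(w in D) (f w)%:E)%E.
Proof.
move=> mD PD mf; rewrite [RHS]integral_mkcond; apply: ae_eq_integral => //.
- exact/measurable_EFinP.
- apply/(measurable_restrictT _ _).1 => //.
  by apply/measurable_EFinP/measurable_funTS.
- exists (~` D); split.
  + exact: measurableC.
  + by have := probability_setC P mD; rewrite PD subee.
  + by move=> w /= wD Dw; apply: wD => _; rewrite patchE ifT//; exact: mem_set.
Qed.

Section SimplexMoments.
Context {R : realType} d (T : measurableType d) (P : probability T R)
  (I : finType) (alpha : I -> {RV P >-> R}) (I0 : (0 < #|I|)%N)
  (alphaU : uniform_on_simplex P (fun i => alpha i : T -> R)).

Definition alpha_box (a : I -> R) : set T :=
  [set w | (forall i, a i <= alpha i w) /\ \sum_i alpha i w = 1].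

Lemma measurable_alpha_box a : measurable (alpha_box a).
Proof.
have -> : alpha_box a = (\bigcap_(i in setT) [set w | a i <= alpha i w]) `&`
    (setT `&` (fun w => \sum_i alpha i w) @^-1` [set 1]).
  apply/seteqP; split => w; first by move=> [aw w1]; split => // i _; exact: aw.
  by move=> [aw [_ w1]]; split => // i; exact: aw.
apply: measurableI.
  apply: fin_bigcap_measurable => // i _.
  by rewrite -[X in measurable X]setTI; exact: measurable_fun_le.
by apply: measurable_sum => // i; exact: measurable_funPT.
Qed.

Definition set_coord (a : I -> R) (p : I) (b : R) : I -> R :=
  fun i => if i == p then b else a i.

Lemma sum_set_coord a p b : a p = 0 -> \sum_i set_coord a p b i = b + \sum_i a i.
Proof.
move=> ap; rewrite (bigD1 p)//= [in RHS](bigD1 p)//= ap add0r /set_coord eqxx.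
by congr (_ + _); apply: eq_bigr => i /negbTE ->.
Qed.

(** Boxes are stable under the cuts made by the layer cake formula: a cut along a coordinate with
    bound 0 only raises that bound to [b]. *)
Lemma alpha_box_set_coord a p b : a p = 0 -> 0 <= b ->
  alpha_box a `&` [set w | b <= alpha p w] = alpha_box (set_coord a p b).
Proof.
move=> ap b0; apply/seteqP; split => w; rewrite /alpha_box /set_coord/=.
  by move=> [[aw w1] bw]; split => // i; case: eqP => // ->.
move=> [aw w1]; split; last by have := aw p; rewrite eqxx.
split => // i; have := aw i; case: eqP => // ->.
by rewrite ap; exact: le_trans.
Qed.

Lemma set_coord_ge0 a p b : (forall i, 0 <= a i) -> 0 <= b ->
  forall i, 0 <= set_coord a p b i.
Proof. by move=> a0 b0 i; rewrite /set_coord; case: ifP. Qed.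

Lemma box_prob a : (forall i, 0 <= a i) ->
  P (alpha_box a) = (#|I|.-1`!%:R * tpow #|I|.-1 (1 - \sum_i a i))%:E.
Proof. exact: uniform_on_simplex_box. Qed.

(** Layer cake with weight 1: the inner integral is the probability of a box whose total bound has
    grown by [b], and integrating over [b] raises the exponent of [tpow] from [n-1] to [n]. *)
Lemma box_moment1 a p : (forall i, 0 <= a i) -> a p = 0 ->
  (\int[P]_(w in alpha_box a) (alpha p w)%:E =
   (#|I|.-1`!%:R * tpow #|I| (1 - \sum_i a i))%:E)%E.
Proof.
move=> a0 ap; under eq_integral do rewrite -[alpha p _]mul1r.
rewrite (@layer_cake _ _ _ P _ (cst 1))//; last 2 first.
- exact: measurable_alpha_box.
- by move=> w [/(_ p)]; rewrite ap.
rewrite -[X in tpow X](prednK I0) -integral_scale_tpow//.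
apply: eq_integral => b; rewrite inE/= in_itv/= andbT => b0.
rewrite alpha_box_set_coord// integral_cst/=; last exact: measurable_alpha_box.
rewrite mul1e box_prob; last exact: set_coord_ge0.
by rewrite sum_set_coord// opprD addrA addrAC.
Qed.

(** Layer cake along [q] with weight [alpha p]. Since [p != q], the cut leaves the bound at [p]
    equal to 0, so the first moment formula applies to the inner integral. *)
Lemma box_moment2 a p q : (forall i, 0 <= a i) -> p != q -> a p = 0 -> a q = 0 ->
  (\int[P]_(w in alpha_box a) (alpha p w * alpha q w)%:E =
   (#|I|.-1`!%:R * tpow #|I|.+1 (1 - \sum_i a i))%:E)%E.
Proof.
move=> a0 pq ap aq.
rewrite layer_cake//; last 3 first.
- exact: measurable_alpha_box.
- by move=> w [/(_ p)]; rewrite ap.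
- by move=> w [/(_ q)]; rewrite aq.
rewrite -integral_scale_tpow//.
apply: eq_integral => b; rewrite inE/= in_itv/= andbT => b0.
rewrite alpha_box_set_coord// box_moment1//; last 2 first.
- exact: set_coord_ge0.
- by rewrite /set_coord (negbTE pq).
by rewrite sum_set_coord// opprD addrA addrAC.
Qed.

Let D := alpha_box (cst 0).
Let n := #|I|.

Lemma simplex_prob : P D = 1%E.
Proof.
rewrite box_prob// big1// subr0 /tpow ler01 expr1n mulrC divfK//.
Qed.

Lemma card_fact_predn : (n`!%:R : R) = n%:R * n.-1`!%:R.
Proof. by move: I0; rewrite /n; case: #|I| => // m _; rewrite factS natrM. Qed.

Lemma simplex_moment1 p : (\int[P]_(w in D) (alpha p w)%:E = (n%:R^-1)%:E)%E.
Proof.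
rewrite box_moment1// big1// subr0 /tpow ler01 expr1n -/n card_fact_predn.
have f0 : (n.-1`!%:R : R) != 0 by rewrite pnatr_eq0 -lt0n fact_gt0.
by rewrite div1r invfM mulrCA divff// mulr1.
Qed.

Lemma simplex_moment_offdiag p q : p != q ->
  (\int[P]_(w in D) (alpha p w * alpha q w)%:E = ((n * n.+1)%:R^-1)%:E)%E.
Proof.
move=> pq; rewrite box_moment2// big1// subr0 /tpow ler01 expr1n -/n.
have f0 : (n.-1`!%:R : R) != 0 by rewrite pnatr_eq0 -lt0n fact_gt0.
rewrite factS natrM card_fact_predn div1r mulrA invfM mulrCA divff// mulr1.
by rewrite mulnC natrM.
Qed.

Lemma simplex_moment2 p q :
  (\int[P]_(w in D) (alpha p w * alpha q w)%:E =
   ((1 + (p == q)%:R) / (n * n.+1)%:R)%:E)%E.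
Proof.
have [<-|pq] := eqVneq p q; last by rewrite simplex_moment_offdiag// addr0 div1r.
have D0 j w : D w -> 0 <= alpha j w by move=> [w0 _]; exact: w0.
(* The diagonal moment is found indirectly: summing [alpha p * alpha q] over all [q] gives [alpha p]
   on [D], whose mean is [1/n], and the other [n - 1] terms are known. *)
have H : (\int[P]_(w in D) (alpha p w * alpha p w)%:E +
    \sum_(q | q != p) \int[P]_(w in D) (alpha p w * alpha q w)%:E = (n%:R^-1)%:E)%E.
  transitivity (\sum_q \int[P]_(w in D) (alpha p w * alpha q w)%:E)%E.
    by rewrite [RHS](bigD1 p).
  rewrite -(simplex_moment1 p) -ge0_integral_sum//.
  - apply: eq_integral => w; rewrite inE => -[_ w1].
    by rewrite sumEFin -mulr_sumr w1 mulr1.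
  - exact: measurable_alpha_box.
  - by move=> r; apply/measurable_EFinP/measurable_funTS; exact: measurable_funM.
  - by move=> r w Dw; rewrite lee_fin mulr_ge0 ?D0.
move: H; under eq_bigr => r rp do rewrite simplex_moment_offdiag 1?eq_sym//.
rewrite sumEFin sumr_const => H.
have {H} -> : (\int[P]_(w in D) (alpha p w * alpha p w)%:E =
  (n%:R^-1)%:E - ((n * n.+1)%:R^-1 *+ #|[pred q | q != p]|)%:E)%E.
  by rewrite -H addeK.
rewrite -EFinB; congr (_%:E).
have nE : n = #|[pred q | q != p]|.+1 by rewrite -[LHS](prednK I0) -(cardC1 p).
rewrite nE (_ : 1 + true%:R = 2 :> R)// natrM; move: #|_| => l.
have l1 : (l.+1%:R : R) != 0 by rewrite pnatr_eq0.
have l2 : (l.+2%:R : R) != 0 by rewrite pnatr_eq0.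
rewrite -(natr1 l.+1) -(natr1 l) in l1 l2 *.
by rewrite -[_ *+ l]mulr_natl; field; rewrite l1 l2.
Qed.

Lemma simplex_linear (c : I -> R) :
  (\int[P]_w (\sum_p alpha p w * c p)%:E = ((\sum_p c p) / n%:R)%:E)%E.
Proof.
rewrite (@integral_full_measure _ _ _ _ D)//; last 3 first.
- exact: measurable_alpha_box.
- exact: simplex_prob.
- by apply: measurable_sum => p; exact: measurable_funM.
under eq_integral do under eq_bigr do rewrite mulrC.
rewrite (@integral_lincomb _ _ _ _ _ _ _ _ (fun=> n%:R^-1))//.
- by rewrite mulr_suml.
- exact: measurable_alpha_box.
- by move=> p w [w0 _]; exact: w0.
- exact: simplex_moment1.
Qed.

(** As the weights sum to 1 on [D], the constant [e] can be moved into each coefficient. In the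
    expanded square, the 1 in the moment [(1 + (p == q)) / (n (n+1))] gives the squared sum and the
    diagonal part gives the sum of squares. *)
Lemma simplex_quadratic (c : I -> R) (e : R) :
  (\int[P]_w ((\sum_p alpha p w * c p - e) ^+ 2)%:E =
   ((\sum_p (c p - e) ^+ 2 + (\sum_p (c p - e)) ^+ 2) / (n * n.+1)%:R)%:E)%E.
Proof.
rewrite (@integral_full_measure _ _ _ _ D)//; last 3 first.
- exact: measurable_alpha_box.
- exact: simplex_prob.
- apply: measurable_funX; apply: measurable_funB => //.
  by apply: measurable_sum => p; exact: measurable_funM.
pose b p := c p - e.
have E w : w \in D -> (\sum_p alpha p w * c p - e) ^+ 2 =
    \sum_(pq : I * I) (b pq.1 * b pq.2) * (alpha pq.1 w * alpha pq.2 w).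
  rewrite inE => -[_ w1].
  have -> : \sum_p alpha p w * c p - e = \sum_p alpha p w * b p.
    rewrite /b; under [RHS]eq_bigr do rewrite mulrBr.
    by rewrite sumrB -mulr_suml w1 mul1r.
  rewrite expr2 big_distrlr pair_big/=; apply: eq_bigr => pq _.
  by rewrite mulrACA mulrC.
under eq_integral => w wD do rewrite E//.
rewrite (@integral_lincomb _ _ _ _ _ _ _ _
  (fun pq => (1 + (pq.1 == pq.2)%:R) / (n * n.+1)%:R))//; last 4 first.
- exact: measurable_alpha_box.
- by move=> pq; exact: measurable_funM.
- by move=> pq w [w0 _]; rewrite mulr_ge0//; exact: w0.
- by move=> pq; exact: simplex_moment2.
congr (_%:E); under eq_bigr do rewrite mulrA.
rewrite -mulr_suml; congr (_ / _).
rewrite -(pair_bigA _ (fun p q => b p * b q * (1 + (p == q)%:R)))/=.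
rewrite [in RHS]expr2 mulr_suml -big_split/=; apply: eq_bigr => p _.
under eq_bigr do rewrite mulrDr mulr1.
rewrite big_split/= mulr_sumr addrC; congr (_ + _).
rewrite (bigD1 p)//= eqxx mulr1 big1 ?addr0 ?expr2// => q.
by rewrite eq_sym => /negbTE ->; rewrite mulr0.
Qed.

End SimplexMoments.

(** * Linear permutation statistics *)

Section PermutationStatistics.
Context {R : realFieldType} (k : nat).
Implicit Types (f a b : 'I_k -> R) (m : 'I_k).

(** Composing with a transposition shows that the sum over [p] does not depend on [m]. Summing it
    over all [m] instead lets each permutation run through every value [l] once. *)
Lemma sum_perm_point f m :
  k%:R * \sum_(p : 'S_k) f (p m) = k`!%:R * \sum_l f l.
Proof.
have E m' : \sum_(p : 'S_k) f (p m') = \sum_(p : 'S_k) f (p m).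
  rewrite (reindex_inj (mulgI (tperm m m')))/=.
  by apply: eq_bigr => p _; rewrite permM tpermR.
transitivity (\sum_m' \sum_(p : 'S_k) f (p m')).
  by rewrite (eq_bigr _ (fun m' _ => E m')) sumr_const card_ord mulr_natl.
rewrite exchange_big/= -card_Sn mulr_natl -sumr_const.
apply: eq_bigr => p _; rewrite (reindex_inj (@perm_inj _ p^-1))/=.
by under eq_bigr do rewrite permKV.
Qed.

(** For each [p], the sum of [b (p m) * b (p l)] over all [l] vanishes. The [k - 1] terms with
    [l != m] have equal sums over [p], by a transposition that fixes [m], so together they cancel
    the diagonal term. *)
Lemma sum_perm_pair b m m' : m' != m -> \sum_l b l = 0 ->
  (k%:R - 1) * \sum_(p : 'S_k) b (p m) * b (p m') = - \sum_(p : 'S_k) b (p m) ^+ 2.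
Proof.
move=> mm' b0.
have E l : l != m -> \sum_(p : 'S_k) b (p m) * b (p l) =
    \sum_(p : 'S_k) b (p m) * b (p m').
  move=> lm; rewrite (reindex_inj (mulgI (tperm m' l)))/=.
  by apply: eq_bigr => p _; rewrite !permM tpermR tpermD.
have : \sum_l \sum_(p : 'S_k) b (p m) * b (p l) = 0.
  rewrite exchange_big big1// => p _; rewrite -mulr_sumr.
  have -> : \sum_l b (p l) = \sum_l b l by rewrite [RHS](reindex_inj (@perm_inj _ p)).
  by rewrite b0 mulr0.
rewrite (bigD1 m)//= (eq_bigr _ E) sumr_const => /eqP.
rewrite addrC addr_eq0 => /eqP.
rewrite (_ : #|_| = k.-1); last by rewrite -[in RHS](card_ord k) -(cardC1 m).
rewrite -[_ *+ k.-1]mulr_natl -subn1 natrB; last by rewrite (leq_ltn_trans _ (ltn_ord m)).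
by move=> ->; congr (- _); apply: eq_bigr => p _; rewrite expr2.
Qed.

Lemma sum_perm_linear_sqr a b : (1 < k)%N -> \sum_m a m = 0 -> \sum_l b l = 0 ->
  \sum_(p : 'S_k) (\sum_m a m * b (p m)) ^+ 2 =
  k`!%:R / (k%:R - 1) * (\sum_m a m ^+ 2) * (\sum_l b l ^+ 2).
Proof.
move=> k1 a0 b0.
have kn0 : (k%:R : R) != 0 by rewrite pnatr_eq0 -lt0n ltnW.
have k1n0 : (k%:R - 1 : R) != 0 by rewrite subr_eq0 pnatr_eq1 gtn_eqF.
pose s := k`!%:R / k%:R * \sum_l b l ^+ 2.
have diag m : \sum_(p : 'S_k) b (p m) ^+ 2 = s.
  by apply: (mulfI kn0); rewrite (sum_perm_point (fun l => b l ^+ 2)) /s; field.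
have offdiag m m' : m' != m -> \sum_(p : 'S_k) b (p m) * b (p m') = - s / (k%:R - 1).
  by move=> mm'; apply: (mulfI k1n0); rewrite sum_perm_pair// diag; field.
(* The mixed sums over [p] are written as a constant plus a diagonal correction, with
   [s + s/(k-1) = s k/(k-1)]. The constant then drops out because [a] sums to 0. *)
transitivity (\sum_m \sum_m' a m * a m' *
    (- s / (k%:R - 1) + (m' == m)%:R * (s * k%:R / (k%:R - 1)))).
  under eq_bigr do rewrite expr2 big_distrlr/=.
  rewrite exchange_big; apply: eq_bigr => m _; rewrite exchange_big; apply: eq_bigr => m' _.
  under eq_bigr do rewrite mulrACA.
  rewrite -mulr_sumr; congr (_ * _); have [->|mm'] := eqVneq m' m.
    by rewrite -(diag m); under eq_bigr do rewrite -expr2; rewrite diag mul1r; field.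
  by rewrite offdiag// mul0r addr0.
transitivity (\sum_m a m ^+ 2 * (s * k%:R / (k%:R - 1))).
  apply: eq_bigr => m _; under eq_bigr do rewrite mulrDr.
  rewrite big_split/= -mulr_suml -mulr_sumr a0 mulr0 mul0r add0r.
  rewrite (bigD1 m)//= eqxx mul1r big1 ?addr0 ?expr2// => m' /negbTE ->.
  by rewrite mul0r mulr0.
by rewrite -mulr_suml /s; field; rewrite k1n0 kn0.
Qed.

End PermutationStatistics.

(** * The checkerboard copula as a permutation statistic *)

Section Checkerboard.
Context {R : realType} (k : nat).

(* [mesh_weight u m] is the fraction of the cell [m/k, (m+1)/k] lying below u. *)
Definition mesh_weight (u : R) (m : 'I_k) : R :=
  let i := Num.truncn (u * k%:R) in
  (m < i)%N%:R + (u * k%:R - i%:R) * (m == i :> nat)%:R.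

(** The index [i = k] arises only at [u = 1], and there the fractional part is 0; this disposes of
    every term with index [k + 1]. *)
Lemma truncn_mesh (u : R) : 0 <= u <= 1 ->
  let i := Num.truncn (u * k%:R) in
  (i <= k)%N /\ ((k <= i)%N -> u * k%:R - i%:R = 0).
Proof.
move=> /andP[u0 u1] i.
have uk0 : 0 <= u * k%:R by rewrite mulr_ge0.
have uk : u * k%:R <= k%:R by rewrite ler_piMl.
have iu : i%:R <= u * k%:R by rewrite /i truncn_le.
have ik : (i <= k)%N by rewrite -(ler_nat R) (le_trans iu).
split => // ki; have ei : i = k by apply/eqP; rewrite eqn_leq ik.
by apply/eqP; rewrite subr_eq0 eq_le iu andbT ei.
Qed.

(** Stated for an arbitrary [g] so that it serves both for the weights, with [g = t], and for their
    squares, with [g = t ^+ 2]. *)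
Lemma sum_mesh (i : nat) (g : R) : (i <= k)%N -> ((k <= i)%N -> g = 0) ->
  \sum_(m < k) ((m < i)%N%:R + g * (m == i :> nat)%:R) = i%:R + g.
Proof.
move=> ik gi; rewrite big_split/= -mulr_sumr; congr (_ + _).
  transitivity (\sum_(m < i) 1 : R); last by rewrite sumr_const card_ord.
  rewrite (big_ord_widen _ (fun=> 1) ik) [RHS]big_mkcond.
  by apply: eq_bigr => m _; case: ifP.
have [ki|ki] := leqP k i; first by rewrite gi// mul0r.
rewrite (bigD1 (Ordinal ki))//= eqxx big1 ?addr0 ?mulr1// => m.
by rewrite -val_eqE/= => /negbTE ->.
Qed.

Lemma sum_mesh_weight u : 0 <= u <= 1 -> \sum_m mesh_weight u m = u * k%:R.
Proof.
by move=> /truncn_mesh[ik gi]; rewrite sum_mesh// addrC subrK.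
Qed.

Lemma sum_mesh_weight_dev u : 0 <= u <= 1 ->
  let t := u * k%:R - (Num.truncn (u * k%:R))%:R in
  \sum_m (mesh_weight u m - u) ^+ 2 = k%:R * u * (1 - u) - t * (1 - t).
Proof.
move=> u01 t; have [ik gi] := truncn_mesh u01.
(* Each weight is 1, [t] or 0, so squaring changes only the cell that contains [u]. *)
have sq : \sum_m mesh_weight u m ^+ 2 = (Num.truncn (u * k%:R))%:R + t ^+ 2.
  rewrite -(sum_mesh ik); last by move=> /gi; rewrite /t => ->; rewrite expr0n.
  apply: eq_bigr => m _; rewrite /mesh_weight -/t.
  case: (ltngtP m (Num.truncn (u * k%:R))) => _ /=; ring.
transitivity (\sum_(m < k) (mesh_weight u m ^+ 2 + (- (2 * u) * mesh_weight u m + u ^+ 2))).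
  by apply: eq_bigr => m _; ring.
rewrite !big_split/= -mulr_sumr sq sum_mesh_weight// sumr_const card_ord.
have -> : (Num.truncn (u * k%:R))%:R = u * k%:R - t by rewrite /t subKr.
rewrite -[_ *+ k]mulr_natl.
clear sq; move: t => t; ring.
Qed.

Lemma discrete_copulaE (p : 'S_k) (i j : nat) : (i <= k)%N -> (j <= k)%N ->
  discrete_copula p i j = k%:R^-1 * \sum_(m < k) (m < i)%N%:R * (p m < j)%N%:R :> R.
Proof.
move=> ik jk; rewrite /discrete_copula ik jk/= mulrC; congr (_ * _).
rewrite -sum1_card natr_sum big_mkcond; apply: eq_bigr => m _.
by rewrite inE; case: (m < i)%N; case: (p m < j)%N; rewrite ?mulr1 ?mulr0.
Qed.

(** Bilinear interpolation factors in each summand: [(1 - t) [m < i] + t [m < i+1]] is the mesh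
    weight of [u] at [m], and likewise for [v] at [p m]. *)
Lemma checkerboard_copulaE (p : 'S_k) (u v : R) : 0 <= u <= 1 -> 0 <= v <= 1 ->
  checkerboard_copula p u v = k%:R^-1 * \sum_m mesh_weight u m * mesh_weight v (p m).
Proof.
move=> /truncn_mesh[]; rewrite /checkerboard_copula /mesh_weight.
move: (Num.truncn (u * k%:R)) => i; move: (u * k%:R - _) => t ik ti.
move=> /truncn_mesh[].
move: (Num.truncn (v * k%:R)) => j; move: (v * k%:R - _) => s jk sj.
(* [S] is the counting formula without the range guard. It may differ from [discrete_copula] at an
   index [k + 1], but there the coefficient [t] or [s] is 0, so only the products are compared. *)
pose S i j : R := k%:R^-1 * \sum_(m < k) (m < i)%N%:R * (p m < j)%N%:R.
have tE j' : (j' <= k)%N -> t * discrete_copula p i.+1 j' = t * S i.+1 j'.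
  move=> j'k; have [/ti ->|ki] := leqP k i; first by rewrite !mul0r.
  by rewrite discrete_copulaE.
have E00 : discrete_copula p i j = S i j by rewrite discrete_copulaE.
have E10 : t * discrete_copula p i.+1 j = t * S i.+1 j by exact: tE.
have E01 : s * discrete_copula p i j.+1 = s * S i j.+1.
  have [/sj ->|kj] := leqP k j; first by rewrite !mul0r.
  by rewrite discrete_copulaE.
have E11 : t * s * discrete_copula p i.+1 j.+1 = t * s * S i.+1 j.+1.
  have [/sj ->|kj] := leqP k j; first by rewrite !mulr0 !mul0r.
  by rewrite mulrAC tE// mulrAC.
rewrite E00 E11 [t * (1 - s)]mulrC -[(1 - s) * t * _]mulrA E10 -[(1 - t) * s * _]mulrA E01.
transitivity (k%:R^-1 * \sum_(m < k) (((1 - t) * (1 - s)) * ((m < i)%N%:R * (p m < j)%N%:R)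
   + ((1 - s) * t) * ((m < i.+1)%N%:R * (p m < j)%N%:R)
   + ((1 - t) * s) * ((m < i)%N%:R * (p m < j.+1)%N%:R)
   + (t * s) * ((m < i.+1)%N%:R * (p m < j.+1)%N%:R))).
  by rewrite !big_split/= -!mulr_sumr /S; ring.
congr (_ * _); apply: eq_bigr => m _; rewrite !ltnS.
by case: (ltngtP m i) => _; case: (ltngtP (p m) j) => _ /=; ring.
Qed.

(** Both families of weights have mean [u] and [v], also after permuting by [p], so centring them
    subtracts exactly [u * v]. *)
Lemma checkerboard_copula_dev (p : 'S_k) (u v : R) : (0 < k)%N ->
  0 <= u <= 1 -> 0 <= v <= 1 ->
  checkerboard_copula p u v - u * v =
  k%:R^-1 * \sum_m (mesh_weight u m - u) * (mesh_weight v (p m) - v).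
Proof.
move=> k0 u01 v01; rewrite checkerboard_copulaE//.
transitivity (k%:R^-1 * \sum_m (mesh_weight u m * mesh_weight v (p m)
    + (- u * mesh_weight v (p m) + (- v * mesh_weight u m + u * v)))); last first.
  by congr (_ * _); apply: eq_bigr => m _; ring.
have pv : \sum_m mesh_weight v (p m) = v * k%:R.
  by rewrite -(sum_mesh_weight v01) [RHS](reindex_inj (@perm_inj _ p)).
rewrite !big_split/= -!mulr_sumr pv sum_mesh_weight// sumr_const card_ord.
rewrite -[_ *+ k]mulr_natl; field.
by rewrite pnatr_eq0 -lt0n.
Qed.

Lemma sum_mesh_weight_centred u : 0 <= u <= 1 -> \sum_m (mesh_weight u m - u) = 0.
Proof.
move=> u01; rewrite sumrB sum_mesh_weight// sumr_const card_ord mulr_natr.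
by rewrite subrr.
Qed.

Lemma sum_checkerboard_dev (u v : R) : (0 < k)%N -> 0 <= u <= 1 -> 0 <= v <= 1 ->
  \sum_(p : 'S_k) (checkerboard_copula p u v - u * v) = 0.
Proof.
move=> k0 u01 v01.
rewrite (eq_bigr _ (fun p _ => checkerboard_copula_dev p k0 u01 v01)) -mulr_sumr.
rewrite exchange_big big1 ?mulr0// => m _; rewrite -mulr_sumr.
apply/eqP; rewrite mulf_eq0; apply/orP; right.
(* The factor [k] is inserted to match [sum_perm_point], whose right-hand side vanishes for centred
   weights. *)
rewrite -(mulrI_eq0 _ (mulfI (_ : k%:R != 0))) ?pnatr_eq0 -?lt0n//.
by rewrite (sum_perm_point (fun l => mesh_weight v l - v)) sum_mesh_weight_centred// mulr0.
Qed.

Lemma sum_checkerboard_dev_sqr (u v : R) : (1 < k)%N -> 0 <= u <= 1 -> 0 <= v <= 1 ->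
  let t := u * k%:R - (Num.truncn (u * k%:R))%:R in
  let s := v * k%:R - (Num.truncn (v * k%:R))%:R in
  \sum_(p : 'S_k) (checkerboard_copula p u v - u * v) ^+ 2 =
  k`!%:R / (k%:R - 1) * (u * (1 - u) - t * (1 - t) / k%:R)
    * (v * (1 - v) - s * (1 - s) / k%:R).
Proof.
move=> k1 u01 v01 t s.
rewrite (eq_bigr (fun p : 'S_k => k%:R^-1 ^+ 2 *
  (\sum_m (mesh_weight u m - u) * (mesh_weight v (p m) - v)) ^+ 2)); last first.
  by move=> p _; rewrite checkerboard_copula_dev ?exprMn// ltnW.
rewrite -mulr_sumr (sum_perm_linear_sqr (a := fun m => mesh_weight u m - u)
  (b := fun m => mesh_weight v m - v)) ?sum_mesh_weight_centred//.
(* The prefactor [k^-2] gives one [1/k] to each sum of squares, turning [k u (1-u) - t (1-t)] into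
   [u (1-u) - t (1-t) / k]. *)
rewrite !sum_mesh_weight_dev// -/t -/s; field.
by rewrite subr_eq0 pnatr_eq1 gtn_eqF//= pnatr_eq0 -lt0n ltnW.
Qed.

End Checkerboard.

(** * Mean and variance of the two random fields *)

Lemma integral_uniform_perm {R : realType} d (T : measurableType d)
    (P : probability T R) (k : nat) (pi : T -> 'S_k) (f : 'S_k -> R) :
  uniform_perm P pi ->
  (\int[P]_w (f (pi w))%:E = ((\sum_p f p) / k`!%:R)%:E)%E.
Proof.
move=> piU.
(* Splitting along the fibres of [pi] turns the integrand into a finite combination of indicators of
   measurable sets of probability [1/k!]. *)
transitivity (\int[P]_w (\sum_(p : 'S_k) f p * \1_(pi @^-1` [set p]) w)%:E)%E.
  apply: eq_integral => w _; congr (_%:E).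
  rewrite (bigD1 (pi w))//= indicE mem_set//= mulr1 big1 ?addr0// => p pw.
  rewrite indicE memNset ?mulr0// => /= /esym/eqP.
  by rewrite (negbTE pw).
rewrite (@integral_lincomb _ _ _ _ _ _ _ _ (fun=> k`!%:R^-1))//.
- by rewrite mulr_suml.
- by move=> p; apply: measurable_indic; case: (piU p).
- move=> p; have [mp Pp] := piU p.
  by rewrite integral_indic// setIT.
Qed.

Theorem theorem5p2 (R : realType) (k : nat) (hk : (2 <= k)%N)
    (d1 : measure_display) (T1 : measurableType d1) (P1 : probability T1 R)
    (pi : T1 -> 'S_k) (hpi : uniform_perm P1 pi)
    (d2 : measure_display) (T2 : measurableType d2) (P2 : probability T2 R)
    (alpha : 'S_k -> {RV P2 >-> R})
    (halpha : uniform_on_simplex P2 (fun p => alpha p : T2 -> R))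
    (u v : R) (hu : 0 <= u <= 1) (hv : 0 <= v <= 1)
    (i j : nat) (hi : i = Num.truncn (u * k%:R)) (hj : j = Num.truncn (v * k%:R))
    (t s : R) (ht : t = u * k%:R - i%:R) (hs : s = v * k%:R - j%:R) :
  let X := checkerboard_field pi u v in
  let Y := mixture_field (fun p => alpha p : T2 -> R) u v in
  [/\ ('E_P2[Y] = 'E_P1[X])%E,
      ('E_P1[X] = (u * v)%:E)%E,
      ('V_P2[Y] = (((k`! + 1)%:R)^-1)%:E * 'V_P1[X])%E &
      ((((k`! + 1)%:R)^-1)%:E * 'V_P1[X])%E =
        (((k`! + 1)%:R * (k%:R - 1))^-1
         * (u * (1 - u) - t * (1 - t) / k%:R)
         * (v * (1 - v) - s * (1 - s) / k%:R))%:E].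
Proof.
move=> X Y.
have k1 : (1 < k)%N by [].
have k0 : (0 < k)%N by exact: ltnW.
have cardk : #|{perm 'I_k}| = k`! by rewrite -card_Sn.
have S0 : (0 < #|{perm 'I_k}|)%N by rewrite cardk fact_gt0.
have kf0 : (k`!%:R : R) != 0 by rewrite pnatr_eq0 -lt0n fact_gt0.
have sumC : \sum_(p : 'S_k) checkerboard_copula p u v = k`!%:R * (u * v).
  have /eqP := sum_checkerboard_dev k0 hu hv.
  by rewrite sumrB subr_eq0 => /eqP ->; rewrite sumr_const cardk mulr_natl.
have EX : ('E_P1[X] = (u * v)%:E)%E.
  rewrite expectation.unlock (integral_uniform_perm (fun p => checkerboard_copula p u v) hpi).
  by rewrite sumC mulrC mulKf.
have EY : ('E_P2[Y] = (u * v)%:E)%E.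
  rewrite expectation.unlock (simplex_linear S0 halpha (fun p => checkerboard_copula p u v)).
  by rewrite sumC cardk mulrC mulKf.
have VX : ('V_P1[X] = ((\sum_(p : 'S_k) (checkerboard_copula p u v - u * v) ^+ 2) / k`!%:R)%:E)%E.
  rewrite /variance covariance.unlock EX/= expectation.unlock.
  by rewrite -(integral_uniform_perm (fun p => (checkerboard_copula p u v - u * v) ^+ 2) hpi).
(* Both variances are the same sum of squared deviations, divided by [k!] for [X] and by
   [k! (k! + 1)] for [Y]; the squared-sum term of [simplex_quadratic] is 0 because the deviations
   from [u * v] sum to 0. *)
have VY : ('V_P2[Y] = ((\sum_(p : 'S_k) (checkerboard_copula p u v - u * v) ^+ 2) /
    (k`! * k`!.+1)%:R)%:E)%E.
  rewrite /variance covariance.unlock EY/= expectation.unlock.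
  rewrite -[in RHS]cardk.
  have := simplex_quadratic S0 halpha (fun p => checkerboard_copula p u v) (u * v).
  by rewrite sum_checkerboard_dev// expr0n addr0 => <-.
split => //.
- by rewrite EX EY.
- rewrite VX VY -EFinM addn1; congr (_%:E).
  by rewrite natrM invfM mulrA mulrC.
- rewrite VX sum_checkerboard_dev_sqr// -hi -hj -ht -hs -EFinM; congr (_%:E).
  have : (k%:R - 1 : R) != 0 by rewrite subr_eq0 pnatr_eq1 gtn_eqF.
  have : ((k`! + 1)%:R : R) != 0 by rewrite addn1 pnatr_eq0.
  have : (k%:R : R) != 0 by rewrite pnatr_eq0 -lt0n.
  move: (_ + 1)%:R => N K0 N0 K1.
  by field; rewrite K0 K1 N0 kf0.
Qed.
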